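(* Let $W:S_C\rightsquigarrow\hat S_C$ be a carrier channel kernel in the setting of a semantic channel as described in the context. Then: (i) $C_{\mathrm{sem}}(W)\le C(W)$; (ii) $C_{\mathrm{sem}}(W)\le\log|S_O|$, hence $C_{\mathrm{sem}}(W)\le\min(C(W),\log|S_O|)$; (iii) if (a) $\mathcal E(s_o)=S_C$ for every $s_o\in S_O$, (b) $\mathcal E_{\mathrm{dec}}(\hat s_c)=\hat S_O$ for every $\hat s_c\in\hat S_C$, and (c) $|S_O|\ge|S_C|$ and $|\hat S_O|\ge|\hat S_C|$, then $C_{\mathrm{sem}}(W)=C(W)$.
   Context: A semantic channel is built from nonempty finite sets $S_O$ (semantic source states), $S_C$ (transmitted carrier states), $\hat S_C$ (received carrier states), $\hat S_O$ (reconstructed semantic states), and set-valued enabling maps $\mathcal E:S_O\Rightarrow S_C$, $\mathcal E_{\mathrm{ch}}:S_C\Rightarrow\hat S_C$, $\mathcal E_{\mathrm{dec}}:\hat S_C\Rightarrow\hat S_O$, each with nonempty values and whose values cover the codomain. A Markov kernel $\kappa:X\rightsquigarrow Y$ is a row-stochastic matrix $\kappa(y\mid x)$; an enabling kernel for an enabling map $\mathcal F:X\Rightarrow Y$ is a Markov kernel with $\mathrm{supp}\,\kappa(\cdot\mid x)\subseteq\mathcal F(x)$ for all $x$. The carrier channel kernel $W$ is an enabling kernel for $\mathcal E_{\mathrm{ch}}$. Given an encoding kernel $\kappa_{\mathrm{enc}}$ (enabling for $\mathcal E$) and a decoding kernel $D$ (enabling for $\mathcal E_{\mathrm{dec}}$),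 the end-to-end kernel is $\kappa_{\mathrm{sem}}(\hat s_o\mid s_o)=\sum_{s_c,\hat s_c}\kappa_{\mathrm{enc}}(s_c\mid s_o)W(\hat s_c\mid s_c)D(\hat s_o\mid\hat s_c)$. For a source distribution $P_O$ on $S_O$, the semantic mutual information $I_{\mathrm{sem}}$ is the Shannon mutual information $I(\mathsf S_o;\hat{\mathsf S}_o)$ under the joint law $P_O(s_o)\kappa_{\mathrm{sem}}(\hat s_o\mid s_o)$. Logarithms are base 2. $C(W):=\max_{P_C\in\Delta(S_C)} I(\mathsf S_c;\hat{\mathsf S}_c)$ under $P_C(s_c)W(\hat s_c\mid s_c)$. The semantic channel capacity is $C_{\mathrm{sem}}(W):=\max I_{\mathrm{sem}}$, the maximum over all $P_O\in\Delta(S_O)$, all encoding kernels enabling for $\mathcal E$ and all decoding kernels enabling for $\mathcal E_{\mathrm{dec}}$. *)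

(* Defs.v *)
From HB Require Import structures.
From mathcomp Require Import all_boot all_order all_algebra.
From mathcomp Require Import all_classical all_reals all_analysis.
Import Order.TTheory GRing.Theory Num.Theory.
Import numFieldTopology.Exports numFieldNormedType.Exports.

Set Implicit Arguments.
Unset Strict Implicit.
Unset Printing Implicit Defensive.

Local Open Scope ring_scope.

Definition log2 (R : realType) (x : R) : R := ln x / ln 2.

Definition is_dist (R : realType) (X : finType) (P : X -> R) : Prop :=
  (forall x, 0 <= P x) /\ \sum_x P x = 1.

(* SC' and SO' below are the received (hatted) versions of SC and SO.
   A kernel [k] from [X] to [Y] is written [k x y] for k(y | x). *)
Definition is_kernel (R : realType) (X Y : finType) (k : X -> Y -> R) : Prop :=
  forall x, is_dist (k x).

Definition enabling_map (X Y : finType) (F : X -> {set Y}) : Prop :=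
  (forall x, F x != finset.set0) /\ (forall y, exists x, y \in F x).

Definition enabling_kernel (R : realType) (X Y : finType) (F : X -> {set Y})
    (k : X -> Y -> R) : Prop :=
  is_kernel k /\ (forall x y, k x y != 0 -> y \in F x).

Definition joint (R : realType) (X Y : finType) (P : X -> R) (k : X -> Y -> R) :
    X -> Y -> R :=
  fun x y => P x * k x y.

(* The convention 0 log (0 / q) = 0 is automatic because the logarithm is
   total; if a marginal vanishes then so does the corresponding joint mass. *)
Definition mutual_info (R : realType) (X Y : finType) (p : X -> Y -> R) : R :=
  \sum_x \sum_y
    p x y * log2 (p x y / ((\sum_y' p x y') * (\sum_x' p x' y))).

(* The greatest element of [A]; the default value 0 is only used when [A] has
   none, which [capacity_max] and [sem_capacity_max] exclude below. *)
Definition max_value (R : realType) (A : set R) : R :=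
  xget 0 [set m | A m /\ ubound A m]%classic.

Definition capacity_values (R : realType) (SC SC' : finType)
    (W : SC -> SC' -> R) : set R :=
  [set v | exists2 P, is_dist P & v = mutual_info (joint P W)]%classic.

Definition capacity (R : realType) (SC SC' : finType) (W : SC -> SC' -> R) : R :=
  max_value (capacity_values W).

Definition sem_kernel (R : realType) (SO SC SC' SO' : finType)
    (enc : SO -> SC -> R) (W : SC -> SC' -> R) (dec : SC' -> SO' -> R) :
    SO -> SO' -> R :=
  fun so so' => \sum_sc \sum_sc' enc so sc * W sc sc' * dec sc' so'.

Definition sem_info (R : realType) (SO SC SC' SO' : finType) (P : SO -> R)
    (enc : SO -> SC -> R) (W : SC -> SC' -> R) (dec : SC' -> SO' -> R) : R :=
  mutual_info (joint P (sem_kernel enc W dec)).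

Definition sem_capacity_values (R : realType) (SO SC SC' SO' : finType)
    (E : SO -> {set SC}) (Edec : SC' -> {set SO'}) (W : SC -> SC' -> R) :
    set R :=
  [set v | exists P enc dec,
     [/\ is_dist P, enabling_kernel E enc, enabling_kernel Edec dec
       & v = sem_info P enc W dec]]%classic.

Definition sem_capacity (R : realType) (SO SC SC' SO' : finType)
    (E : SO -> {set SC}) (Edec : SC' -> {set SO'}) (W : SC -> SC' -> R) : R :=
  max_value (sem_capacity_values E Edec W).

Section attained.
Local Open Scope classical_set_scope.
Variable R : realType.
Implicit Types X Y : finType.

Definition xlnx (x : R) : R := x * ln x.

Lemma norm_xlnx_le (x : R) : 0 < x -> x < 1 -> `|xlnx x| <= 2 * Num.sqrt x.
Proof.
move=> x0 x1; have s0 : 0 < Num.sqrt x by rewrite sqrtr_gt0.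
have xE : x = Num.sqrt x * Num.sqrt x by rewrite -expr2 sqr_sqrtr// ltW.
have lx0 : ln x <= 0 by rewrite ln_le0// ltW.
rewrite /xlnx normrM (gtr0_norm x0) (ler0_norm lx0).
have -> : - ln x = 2 * ln (Num.sqrt x)^-1.
  by rewrite lnV ?posrE// {1}xE lnM ?posrE// mulrN mulr_natl mulr2n.
have := ln_sublinear (_ : 0 < (Num.sqrt x)^-1); rewrite invr_gt0 => /(_ s0)/ltW le.
apply: (le_trans (ler_wpM2l (ltW x0) (ler_wpM2l (ler0n _ 2) le))).
by rewrite {1}xE mulrCA -mulrA divff ?mulr1 ?gt_eqF.
Qed.

Lemma continuous_xlnx : continuous xlnx.
Proof.
move=> x; have [x0|x0|->] := ltgtP x 0.
- apply: (@near_cst_continuous _ _ 0 xlnx x).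
  near=> y; rewrite /xlnx ln0 ?mulr0// ltW//; near: y; exact: lt_nbhsl.
- by apply: continuousM => //; exact: continuous_ln.
have h0 : xlnx 0 = 0 by rewrite /xlnx mul0r.
rewrite /continuous_at h0.
apply/cvgr0Pnorm_lt => e e0.
have s0 : (Num.sqrt y @[y --> (0 : R)] --> 0)%R.
  by rewrite -[X in _ --> X]sqrtr0; exact: sqrt_continuous.
have e2 : 0 < e / 2 by rewrite divr_gt0.
move/cvgr0Pnorm_lt : s0 => /(_ _ e2) s0.
near=> y.
have [y0|y0] := leP y 0; first by rewrite /xlnx ln0// mulr0 normr0.
apply: le_lt_trans (norm_xlnx_le y0 _) _.
  by near: y; exact: lt_nbhsl.
rewrite mulrC -ltr_pdivlMr//; apply: le_lt_trans (ler_norm _) _.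
by near: y.
Unshelve. all: by end_near. Qed.

(* Entropy form of [mutual_info], which agrees with it on nonnegative arguments
   and is continuous everywhere. *)
Definition xlnx_info X Y (p : X -> Y -> R) : R :=
  (\sum_x \sum_y xlnx (p x y)
   - \sum_x xlnx (\sum_y p x y) - \sum_y xlnx (\sum_x p x y)) / ln 2.

Lemma mutual_infoE X Y (p : X -> Y -> R) : (forall x y, 0 <= p x y) ->
  mutual_info p = xlnx_info p.
Proof.
move=> p0.
have -> : xlnx_info p = \sum_x \sum_y (xlnx (p x y) - p x y * ln (\sum_y' p x y')
     - p x y * ln (\sum_x' p x' y)) / ln 2.
  rewrite /xlnx_info; under [in RHS]eq_bigr do rewrite -mulr_suml.
  rewrite -mulr_suml; congr (_ / _).
  under [in RHS]eq_bigr do rewrite !sumrB.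
  rewrite !sumrB; congr (_ - _ - _).
    by apply: eq_bigr => x _; rewrite /xlnx mulr_suml.
  by rewrite exchange_big; apply: eq_bigr => y _; rewrite /xlnx mulr_suml.
apply: eq_bigr => x _; apply: eq_bigr => y _.
rewrite /log2 mulrA; congr (_ / _).
have [->|pxy] := eqVneq (p x y) 0; first by rewrite /xlnx !mul0r !subr0.
have pxy0 : 0 < p x y by rewrite lt_def pxy p0.
have r0 : 0 < \sum_y' p x y'.
  by rewrite (bigD1 y)//= ltr_pwDl// sumr_ge0.
have c0 : 0 < \sum_x' p x' y.
  by rewrite (bigD1 x)//= ltr_pwDl// sumr_ge0.
rewrite lnM ?posrE ?invr_gt0 ?mulr_gt0// lnV ?posrE ?mulr_gt0//.
by rewrite lnM ?posrE// /xlnx opprD !mulrDr !mulrN addrA.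
Qed.

Lemma sum_cont (T : topologicalType) (I : finType) (f : I -> T -> R) :
  (forall i, continuous (f i)) -> continuous (fun t => \sum_i f i t).
Proof.
by move=> cf; apply: continuous_big => [|i _]; [exact: add_continuous|exact: cf].
Qed.

Lemma mul_cont (T : topologicalType) (f g : T -> R) :
  continuous f -> continuous g -> continuous (fun t => f t * g t).
Proof. by move=> cf cg t; apply: continuousM; [exact: cf|exact: cg]. Qed.

Lemma xlnx_info_cont (T : topologicalType) X Y (p : T -> X -> Y -> R) :
  (forall x y, continuous (fun t => p t x y)) -> continuous (fun t => xlnx_info (p t)).
Proof.
move=> cp; have hc (f : T -> R) : continuous f -> continuous (xlnx \o f).
  by move=> cf t; apply: continuous_comp; [exact: cf|exact: continuous_xlnx].
apply: mul_cont; last by move=> ?; exact: cst_continuous.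
have subc (f g : T -> R) : continuous f -> continuous g ->
    continuous (fun t => f t - g t).
  by move=> cf cg t; apply: continuousB; [exact: cf|exact: cg].
apply: (subc); first apply: (subc).
- by apply: sum_cont => x; apply: sum_cont => y; exact: hc.
- by apply: sum_cont => x; apply: hc; exact: sum_cont.
- by apply: sum_cont => y; apply: hc; exact: sum_cont.
Qed.

Lemma closed_dist (T : topologicalType) X (P : T -> X -> R) :
  (forall x, continuous (fun t => P t x)) -> closed [set t | is_dist (P t)].
Proof.
move=> cP.
have -> : [set t | is_dist (P t)] =
   (\bigcap_x (fun t => P t x) @^-1` [set y | 0 <= y])
   `&` (fun t => \sum_x P t x) @^-1` [set 1].
  apply/seteqP; split=> t [a b]; split=> // x; first by move=> _; exact: a.
  exact: a x Logic.I.
apply: closedI.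
  apply: closed_bigI => x _; apply: closed_comp; last exact: closed_ge.
  by move=> t _; exact: cP.
apply: closed_comp; last exact: closed_eq.
by move=> t _; exact: sum_cont.
Qed.

Lemma closed_enabling (T : topologicalType) X Y (F : X -> {set Y})
    (k : T -> X -> Y -> R) : (forall x y, continuous (fun t => k t x y)) ->
  closed [set t | enabling_kernel F (k t)].
Proof.
move=> ck.
have -> : [set t | enabling_kernel F (k t)] =
   (\bigcap_x [set t | is_dist (k t x)]) `&`
   (\bigcap_(z in [set z : X * Y | z.2 \notin F z.1])
      (fun t => k t z.1 z.2) @^-1` [set 0]).
  apply/seteqP; split=> t [a b]; split.
  - by move=> x _; exact: a.
  - by move=> -[x y] /= /negP nF; apply/eqP/negPn/negP => /b.
  - by move=> x; exact: a x Logic.I.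
  - move=> x y; apply: contraNT => nF; apply/eqP; exact: (b (x, y)).
apply: closedI; apply: closed_bigI => z _; first exact: closed_dist.
by apply: closed_comp; [move=> t _; exact: ck|exact: closed_eq].
Qed.

Lemma dist_le1 X (P : X -> R) x : is_dist P -> 0 <= P x <= 1.
Proof.
move=> [P0 P1]; rewrite P0 -P1 (bigD1 x)//= lerDl.
by rewrite sumr_ge0.
Qed.

Lemma dirac_dist X (x : X) : is_dist (fun y => (y == x)%:R : R).
Proof.
split=> [y|]; first by rewrite ler0n.
by rewrite (bigD1 x)//= eqxx big1 ?addr0// => y /negPf ->.
Qed.

Lemma dirac_enabling X Y (F : X -> {set Y}) : enabling_map F ->
  exists k : X -> Y -> R, enabling_kernel F k.
Proof.
move=> [F0 _].
have /choice[f fF] : forall x, exists y, y \in F x.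
  by move=> x; have /set0Pn := F0 x.
exists (fun x y => (y == f x)%:R); split=> [x|x y]; first exact: dirac_dist.
by have [->|] := eqVneq y (f x); rewrite ?eqxx.
Qed.

Lemma box_EVT (I : finType) (A : set (prod_topology (fun _ : I => R)))
    (f : prod_topology (fun _ : I => R) -> R) :
  A !=set0 -> closed A -> (forall w, A w -> forall i, 0 <= w i <= 1) ->
  continuous f -> exists2 c, A c & forall w, A w -> f w <= f c.
Proof.
move=> A0 cA bA cf.
have kA : compact A.
  have -> : A = [set w | forall i, `[0%R, 1%R]%classic (w i)] `&` A.
    apply/seteqP; split=> [w Aw|w []//]; split=> // i /=.
    by rewrite in_itv/=; exact: bA.
  apply: compact_closedI => //.
  exact: (@tychonoff I (fun=> R) (fun=> `[0%R, 1%R]%classic)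
    (fun=> @segment_compact R 0 1)).
have [c cA' cmax] := compact_EVT_max A0 kA (continuous_subspaceT cf).
by exists c; [rewrite inE in cA'|move=> w Aw; apply: cmax; rewrite inE].
Qed.

Lemma coord_cont (I : finType) (i : I) :
  continuous (fun w : prod_topology (fun _ : I => R) => w i).
Proof. exact: (@proj_continuous I (fun=> R) i). Qed.

Lemma max_valueP (A : set R) : (exists m, A m /\ ubound A m) ->
  A (max_value A) /\ ubound A (max_value A).
Proof. by move=> /(xgetPex 0)[]. Qed.

Lemma capacity_max (SC SC' : finType) (W : SC -> SC' -> R) :
  (0 < #|SC|)%N -> is_kernel W ->
  capacity_values W (capacity W) /\ ubound (capacity_values W) (capacity W).
Proof.
move=> /card_gt0P[sc _] kW; apply: max_valueP.
have jE (P : SC -> R) : is_dist P ->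
    mutual_info (joint P W) = xlnx_info (joint P W).
  move=> [P0 _]; apply: mutual_infoE => x y.
  by rewrite mulr_ge0//; exact: (kW x).1.
have [|||| P dP Pmax] := @box_EVT SC [set P | is_dist P] (fun P => xlnx_info (joint P W)).
- by eexists; exact: (dirac_dist sc).
- apply: (@closed_dist _ _ (fun P : prod_topology _ => (P : SC -> R))) => x.
  exact: coord_cont.
- by move=> w dw i; exact: dist_le1.
- apply: xlnx_info_cont => x y; apply: mul_cont; first exact: coord_cont.
  by move=> ?; exact: cst_continuous.
exists (mutual_info (joint P W)); split; first by exists P.
by move=> _ [Q dQ ->]; rewrite !jE//; exact: Pmax.
Qed.

Lemma sem_capacity_max (SO SC SC' SO' : finType)
    (E : SO -> {set SC}) (Edec : SC' -> {set SO'}) (W : SC -> SC' -> R) :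
  (0 < #|SO|)%N -> enabling_map E -> enabling_map Edec -> is_kernel W ->
  sem_capacity_values E Edec W (sem_capacity E Edec W) /\
  ubound (sem_capacity_values E Edec W) (sem_capacity E Edec W).
Proof.
move=> /card_gt0P[so _] mE mD kW; apply: max_valueP.
have semE P enc dec : is_dist P -> enabling_kernel E enc ->
    enabling_kernel Edec dec ->
    sem_info P enc W dec = xlnx_info (joint P (sem_kernel enc W dec)).
  move=> [P0 _] [ke _] [kd _]; apply: mutual_infoE => x y.
  apply: mulr_ge0 => //; apply: sumr_ge0 => a _; apply: sumr_ge0 => b _.
  rewrite !mulr_ge0//; [exact: (ke x).1|exact: (kW a).1|exact: (kd b).1].
pose I : finType := ((SO + (SO * SC)) + (SC' * SO'))%type.
pose T := prod_topology (fun _ : I => R).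
pose P_ (w : T) s : R := w (inl (inl s)).
pose e_ (w : T) s c : R := w (inl (inr (s, c))).
pose d_ (w : T) c s : R := w (inr (c, s)).
have cP s : continuous (fun w => P_ w s) by exact: coord_cont.
have ce s c : continuous (fun w => e_ w s c) by exact: coord_cont.
have cd c s : continuous (fun w => d_ w c s) by exact: coord_cont.
pose mk P e d : T := fun i => match i with
  | inl (inl s) => P s | inl (inr z) => e z.1 z.2 | inr z => d z.1 z.2 end.
pose A := [set w : T | is_dist (P_ w)] `&`
  ([set w | enabling_kernel E (e_ w)] `&` [set w | enabling_kernel Edec (d_ w)]).
have [|||| w [dP [ke kd]] wmax] :=
  @box_EVT I A (fun w => xlnx_info (joint (P_ w) (sem_kernel (e_ w) W (d_ w)))).
- have [e ke] := dirac_enabling mE; have [d kd] := dirac_enabling mD.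
  by exists (mk (fun y => (y == so)%:R) e d); split=> //; exact: dirac_dist.
- apply: closedI; first exact: closed_dist.
  by apply: closedI; exact: closed_enabling.
- move=> w [dP [ke kd]] [[s|[s c]]|[c s]].
  + exact: dist_le1 dP.
  + exact: dist_le1 (ke.1 s).
  + exact: dist_le1 (kd.1 c).
- apply: xlnx_info_cont => x y; apply: mul_cont => //.
  apply: sum_cont => a; apply: sum_cont => b; apply: mul_cont => //.
  by apply: mul_cont => // ?; exact: cst_continuous.
exists (sem_info (P_ w) (e_ w) W (d_ w)); split.
  by exists (P_ w), (e_ w), (d_ w).
move=> _ [P [e [d [dP' ke' kd' ->]]]]; rewrite !semE//.
by apply: (wmax (mk P e d)).
Qed.

End attained.

(* Main.v *)
Require Import Defs.
From mathcomp Require Import all_boot all_order all_algebra.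
From mathcomp Require Import all_classical all_reals all_analysis.
Import Order.TTheory GRing.Theory Num.Theory.

Set Implicit Arguments.
Unset Strict Implicit.
Unset Printing Implicit Defensive.

Local Open Scope ring_scope.

(* Everything rests on the log-sum inequality. It shows that mutual information
   does not increase when both variables are sent through Markov kernels; the
   joint law of (s_o, \hat s_o) is obtained from that of (s_c, \hat s_c) by
   applying the decoder on one side and the Bayes inverse of the encoder on the
   other, which gives (i). Compared with the counting measure, it bounds the
   entropy of the source, which gives (ii). For (iii), a capacity-achieving input
   is moved along an injection S_C -> S_O, and the output along an injection
   \hat S_C -> \hat S_O; both have left inverses, so processing with these
   recovers the carrier law and no information is lost. *)

(** Summand by summand this is [ln t <= t - 1]; the linear corrections it produces cancel in the
    total. *)
Lemma log_sum_le (R : realType) (I : finType) (a b : I -> R) :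
  (forall i, 0 <= a i) -> (forall i, 0 <= b i) ->
  (forall i, b i = 0 -> a i = 0) ->
  (\sum_i a i) * log2 ((\sum_i a i) / (\sum_i b i)) <=
  \sum_i a i * log2 (a i / b i).
Proof.
move=> a0 b0 ab; set A := \sum_i a i; set B := \sum_i b i.
have ln2 : 0 < ln (2 : R) by rewrite ln_gt0// ltr1n.
have [A0|An0] := eqVneq A 0.
  have az i : a i = 0 by move/psumr_eq0P : A0 => ->.
  by rewrite A0 mul0r big1// => i _; rewrite az mul0r.
have Apos : 0 < A by rewrite lt_def An0 sumr_ge0.
have Bpos : 0 < B.
  rewrite lt_def sumr_ge0// andbT; apply: contra_neq An0 => B0.
  by apply: big1 => i _; apply: ab; move/psumr_eq0P : B0 => ->.
(* For [a i] positive, take [t = b i * (A / B) / a i]. Summed over [i], the correction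
   [a i - b i * (A / B)] gives [A - B * (A / B) = 0]. *)
have termwise i : a i * ln (A / B) + (a i - b i * (A / B)) <= a i * ln (a i / b i).
  have [ai|ain0] := eqVneq (a i) 0.
    by rewrite ai !mul0r add0r sub0r oppr_le0 mulr_ge0// divr_ge0// ltW.
  have ai : 0 < a i by rewrite lt_def ain0 a0.
  have bi : 0 < b i.
    by rewrite lt_def b0 andbT; apply: contra_neq ain0; exact: ab.
  rewrite addrC -lerBrDr -mulrBr -ln_div ?posrE ?divr_gt0//.
  have t0 : 0 < b i * (A / B) / a i by rewrite !divr_gt0// mulr_gt0// divr_gt0.
  have -> : a i / b i / (A / B) = (b i * (A / B) / a i)^-1.
    by rewrite [RHS]invf_div [in RHS]invfM mulrA.
  rewrite lnV ?posrE// mulrN.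
  have -> : a i - b i * (A / B) = - (a i * (b i * (A / B) / a i - 1)).
    by rewrite mulrBr mulr1 [a i * (_ / _)]mulrC divfK// opprB.
  rewrite lerN2 ler_wpM2l// -[X in ln X](subrKC 1) le_ln1Dx//.
  by rewrite ltrBrDl subrr.
rewrite /log2 mulrA; under eq_bigr do rewrite mulrA.
rewrite -mulr_suml ler_pM2r ?invr_gt0//.
apply: le_trans (ler_sum _ (fun i _ => termwise i)).
by rewrite big_split/= sumrB -!mulr_suml -/A -/B [B * _]mulrC divfK ?gt_eqF//
  subrr addr0.
Qed.

(** Each output cell [(x', y')] mixes input cells with weights [u x x' * v y y'], for the joint law
    and for the product of marginals alike. The log-sum inequality applies in each cell, and the
    weights sum to 1 over all cells. *)
Lemma mutual_info_processing (R : realType) (X X' Y Y' : finType)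
    (u : X -> X' -> R) (v : Y -> Y' -> R) (p : X -> Y -> R) :
  is_kernel u -> is_kernel v -> (forall x y, 0 <= p x y) ->
  mutual_info (fun x' y' => \sum_x \sum_y u x x' * p x y * v y y') <=
  mutual_info p.
Proof.
move=> ku kv p0; rewrite /mutual_info.
pose r x := \sum_y p x y; pose c y := \sum_x p x y.
have r0 x : 0 <= r x by exact: sumr_ge0.
have c0 y : 0 <= c y by exact: sumr_ge0.
pose q x' y' := \sum_x \sum_y u x x' * p x y * v y y'.
have qrow x' : \sum_y' q x' y' = \sum_x u x x' * r x.
  rewrite exchange_big/=; apply: eq_bigr => x _.
  rewrite exchange_big/= mulr_sumr; apply: eq_bigr => y _.
  by rewrite -mulr_sumr (kv y).2 mulr1.
have qcol y' : \sum_x' q x' y' = \sum_y c y * v y y'.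
  rewrite exchange_big/=.
  under eq_bigr do rewrite exchange_big/=.
  rewrite exchange_big/=; apply: eq_bigr => y _.
  rewrite mulr_suml; apply: eq_bigr => x _.
  by rewrite -2!mulr_suml (ku x).2 mul1r.
(* Absolute continuity with respect to the product of marginals, the side condition of the log-sum
   inequality. *)
have pz x y : r x * c y = 0 -> p x y = 0.
  move/eqP; rewrite mulf_eq0 => /orP[] /eqP /psumr_eq0P h; exact: h.
have bound x' y' : q x' y' * log2 (q x' y' / ((\sum_y q x' y) * (\sum_x q x y')))
    <= \sum_x \sum_y u x x' * p x y * v y y' * log2 (p x y / (r x * c y)).
  pose a (z : X * Y) := u z.1 x' * p z.1 z.2 * v z.2 y'.
  pose b (z : X * Y) := u z.1 x' * (r z.1 * c z.2) * v z.2 y'.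
  have -> : q x' y' = \sum_z a z by rewrite /q pair_big.
  have -> : (\sum_y q x' y) * (\sum_x q x y') = \sum_z b z.
    rewrite qrow qcol big_distrlr pair_big/=; apply: eq_bigr => z _.
    by rewrite /b !mulrA.
  apply: le_trans (@log_sum_le R _ a b _ _ _) _.
  - by move=> z; rewrite !mulr_ge0// ?(ku z.1).1 ?(kv z.2).1.
  - by move=> z; rewrite !mulr_ge0// ?(ku z.1).1 ?(kv z.2).1.
  - move=> z /eqP; rewrite /a mulf_eq0 [u _ _ * _ == 0]mulf_eq0.
    by move=> /orP[/orP[/eqP->|/eqP/pz->]|/eqP->]; rewrite ?mulr0 ?mul0r.
  rewrite pair_big/=; apply: ler_sum => z _.
  (* When [a z] is nonzero both kernel weights are nonzero, so they cancel in [a z / b z]. *)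
  rewrite -/(a z); have [->|] := eqVneq (a z) 0; first by rewrite !mul0r.
  rewrite /a /b !mulf_eq0 !negb_or => /andP[/andP[uz _] vz].
  by rewrite -mulf_div divff// mulr1 -mulf_div divff// mul1r.
apply: le_trans (ler_sum _ (fun x' _ => ler_sum _ (fun y' _ => bound x' y'))) _.
rewrite le_eqVlt; apply/orP; left; apply/eqP.
under eq_bigr do rewrite exchange_big/=.
rewrite exchange_big/=; apply: eq_bigr => x _.
under eq_bigr do rewrite exchange_big/=.
rewrite exchange_big/=; apply: eq_bigr => y _.
rewrite -/(r x) -/(c y); set l := log2 _.
rewrite -[RHS]mul1r -(ku x).2 mulr_suml; apply: eq_bigr => x' _.
rewrite -[in RHS](mulr1 (u x x')) -(kv y).2 mulr_sumr mulr_suml.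
by apply: eq_bigr => y' _; rewrite !mulrA (mulrAC (u x x') (p x y)).
Qed.

(** Since [p x y] is at most its column sum, each logarithm is at most that of [(r x)^-1], so the
    entropy of [r] is an upper bound; the log-sum inequality with weights 1 bounds that entropy. *)
Lemma mutual_info_le_log_card (R : realType) (X Y : finType) (p : X -> Y -> R) :
  (forall x y, 0 <= p x y) -> \sum_x \sum_y p x y = 1 ->
  mutual_info p <= log2 (#|X|%:R : R).
Proof.
move=> p0 p1; pose r x := \sum_y p x y.
have r0 x : 0 <= r x by exact: sumr_ge0.
have ln2 : 0 < ln (2 : R) by rewrite ln_gt0// ltr1n.
(* The case [t = 0] holds by the defaults [0^-1 = 0] and [ln 0 = 0]; it is needed because [r x] may
   vanish. *)
have log2V (t : R) : 0 <= t -> log2 t^-1 = - log2 t.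
  rewrite le_eqVlt => /orP[/eqP<-|t0]; first by rewrite /log2 invr0 ln0// mul0r oppr0.
  by rewrite /log2 lnV ?posrE// mulNr.
have r1 x : (1 : R) = 0 -> r x = 0 by move/eqP; rewrite oner_eq0.
have := @log_sum_le R X r (fun=> 1) r0 (fun=> ler01) r1.
rewrite {1 2}/r p1 mul1r sumr_const div1r log2V ?ler0n// lerNl => le_entropy.
apply: le_trans le_entropy.
rewrite -sumrN; apply: ler_sum => x _.
rewrite divr1 -mulrN -log2V// {1}/r mulr_suml; apply: ler_sum => y _.
have [->|pn0] := eqVneq (p x y) 0; first by rewrite !mul0r.
have pxy : 0 < p x y by rewrite lt_def pn0 p0.
have c0 : p x y <= \sum_x' p x' y by rewrite (bigD1 x)//= lerDl sumr_ge0.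
have rx : 0 < r x by rewrite /r (bigD1 y)//= ltr_pwDl// sumr_ge0.
have cy := lt_le_trans pxy c0.
rewrite ler_pM2l// /log2 ler_pM2r ?invr_gt0// ler_ln ?posrE ?invr_gt0//; last first.
  by rewrite divr_gt0// mulr_gt0.
by rewrite ler_pdivrMr ?mulr_gt0// mulKf ?gt_eqF.
Qed.

(** Elements with the same position in the two enumerations are matched. The default [y0] is never
    reached; [x0] is the value of [g] at positions beyond [#|A|]. *)
Lemma leq_card_cancel (A B : finType) : (0 < #|A|)%N -> (#|A| <= #|B|)%N ->
  exists (f : A -> B) (g : B -> A), cancel f g.
Proof.
move=> A0 leAB; have /card_gt0P[y0 _] := leq_trans A0 leAB.
have /card_gt0P[x0 _] := A0.
exists (fun x => nth y0 (enum B) (index x (enum A))).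
exists (fun y => nth x0 (enum A) (index y (enum B))) => x /=.
have lt_x : (index x (enum A) < size (enum A))%N by rewrite index_mem mem_enum.
rewrite index_uniq ?enum_uniq ?nth_index ?mem_enum//.
by apply: leq_trans lt_x _; rewrite -!cardE.
Qed.

Lemma sum_dirac (R : pzRingType) (X : finType) (x : X) (F : X -> R) :
  \sum_y (y == x)%:R * F y = F x.
Proof.
rewrite (bigD1 x)//= eqxx mul1r big1 ?addr0// => y /negPf ->.
by rewrite mul0r.
Qed.

Section SemanticChannel.
Context {R : realType} {SO SC SC' SO' : finType}.
Context {W : SC -> SC' -> R}.

Lemma is_kernel_sem_kernel (enc : SO -> SC -> R) (dec : SC' -> SO' -> R) :
  is_kernel enc -> is_kernel W -> is_kernel dec ->
  is_kernel (sem_kernel enc W dec).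
Proof.
move=> ke kW kd x; split=> [y|].
  by apply: sumr_ge0 => a _; apply: sumr_ge0 => b _;
     rewrite !mulr_ge0// ?(ke x).1 ?(kW a).1 ?(kd b).1.
rewrite exchange_big/= -(ke x).2; apply: eq_bigr => a _.
rewrite exchange_big/= -[RHS]mulr1 -(kW a).2 mulr_sumr; apply: eq_bigr => b _.
by rewrite -mulr_sumr (kd b).2 mulr1.
Qed.

Lemma sem_info_le (P : SO -> R) (enc : SO -> SC -> R) (dec : SC' -> SO' -> R) :
  is_dist P -> is_kernel enc -> is_kernel W -> is_kernel dec ->
  exists2 Q, is_dist Q & sem_info P enc W dec <= mutual_info (joint Q W).
Proof.
move=> dP ke kW kd.
have m0 s c : 0 <= P s * enc s c by rewrite mulr_ge0 ?dP.1 ?(ke s).1.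
pose Q c := \sum_s P s * enc s c.
have dQ : is_dist Q.
  split=> [c|]; first exact: sumr_ge0.
  rewrite exchange_big/= -dP.2; apply: eq_bigr => s _.
  by rewrite -mulr_sumr (ke s).2 mulr1.
(* Bayes inverse of the encoder; where [Q] vanishes any law will do. *)
pose bayes c s := if Q c == 0 then P s else P s * enc s c / Q c.
have kbayes : is_kernel bayes.
  move=> c; rewrite /bayes; case: eqVneq => // Qc; split=> [s|].
    by rewrite divr_ge0// dQ.1.
  by rewrite -mulr_suml divff.
(* This survives [Q c = 0]: a vanishing sum of nonnegative terms has only zero terms. *)
have bayesE c s : bayes c s * Q c = P s * enc s c.
  rewrite /bayes; case: eqVneq => [Qc|Qc]; last by rewrite divfK.
  by rewrite Qc mulr0; move/psumr_eq0P : Qc => ->.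
exists Q => //.
have -> : sem_info P enc W dec = mutual_info (fun s s' =>
    \sum_c \sum_c' bayes c s * joint Q W c c' * dec c' s').
  congr mutual_info; apply/funext => s; apply/funext => s'.
  rewrite /joint /sem_kernel mulr_sumr; apply: eq_bigr => c _.
  rewrite mulr_sumr; apply: eq_bigr => c' _.
  by rewrite !mulrA bayesE.
by apply: mutual_info_processing => // c c'; rewrite mulr_ge0 ?dQ.1 ?(kW c).1.
Qed.

(** The source [Q] is the image of [P] under [f]. The encoder [g] undoes [f], so the channel input
    again has law [P], and [k] undoes the decoder [h]. *)
Lemma mutual_info_le_sem_info (P : SC -> R)
    (f : SC -> SO) (g : SO -> SC) (h : SC' -> SO') (k : SO' -> SC') :
  cancel f g -> cancel h k -> is_dist P -> is_kernel W ->
  exists2 Q, is_dist Q & mutual_info (joint P W) <=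
    sem_info Q (fun s c => (c == g s)%:R) W (fun c' s' => (s' == h c')%:R).
Proof.
move=> fK hK dP kW; pose Q s := \sum_c P c * (s == f c)%:R.
have dQ : is_dist Q.
  split=> [s|]; first by apply: sumr_ge0 => c _; rewrite mulr_ge0 ?dP.1 ?ler0n.
  rewrite exchange_big/= -[RHS]dP.2; apply: eq_bigr => c _.
  under eq_bigr do rewrite mulrC.
  exact: (sum_dirac (f c) (fun=> P c)).
have ksem := @is_kernel_sem_kernel (fun s c => (c == g s)%:R)
  (fun c' s' => (s' == h c')%:R) (fun s => dirac_dist R (g s)) kW
  (fun c' => dirac_dist R (h c')).
exists Q => //.
(* The carrier law is the end-to-end law processed by the deterministic kernels of [g] and [k]. *)
have -> : joint P W = fun c c' => \sum_s \sum_s' (c == g s)%:R *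
    joint Q (sem_kernel (fun s c => (c == g s)%:R) W
                        (fun c' s' => (s' == h c')%:R)) s s' * (c' == k s')%:R.
  apply/funext => c; apply/funext => c'.
  have inner s : \sum_s' (c == g s)%:R * joint Q (sem_kernel
      (fun s c => (c == g s)%:R) W (fun c' s' => (s' == h c')%:R)) s s' *
      (c' == k s')%:R = (c == g s)%:R * Q s * W (g s) c'.
    (* The encoder mass sits at [g s], the decoder mass at [h c1], and [k (h c1) = c1], which leaves
       [W (g s) c']. *)
    under eq_bigr => s' _.
      rewrite /joint /sem_kernel.
      under eq_bigr => c1 _.
        under eq_bigr do rewrite -mulrA.
        rewrite -mulr_sumr; over.
      rewrite sum_dirac mulrA -mulrA mulr_suml; over.
    rewrite /= -mulr_sumr; congr (_ * _).
    rewrite exchange_big/=.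
    under eq_bigr => c1 _.
      under eq_bigr => s' _ do rewrite -mulrA mulrCA.
      rewrite sum_dirac hK mulrC eq_sym; over.
    exact: sum_dirac.
  under eq_bigr do rewrite inner.
  (* Expanding [Q] puts the mass of [s] at [f c1]; then [g (f c1) = c1] forces [c1 = c]. *)
  under eq_bigr => s _ do rewrite /Q mulr_sumr mulr_suml.
  rewrite exchange_big/=.
  under eq_bigr => c1 _.
    under eq_bigr => s _ do rewrite mulrA mulrC mulrA [_ * (s == _)%:R]mulrC.
    rewrite sum_dirac fK; over.
  rewrite /=.
  under eq_bigr => c1 _ do rewrite [W _ _ * _]mulrC -mulrA eq_sym.
  by rewrite sum_dirac.
apply: mutual_info_processing => [s|s'|s s']; [exact: dirac_dist..|].
by rewrite mulr_ge0 ?dQ.1 ?(ksem s).1.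
Qed.

End SemanticChannel.

Theorem theorem2 (R : realType) (SO SC SC' SO' : finType)
    (hSO : (0 < #|SO|)%N) (hSC : (0 < #|SC|)%N)
    (hSC' : (0 < #|SC'|)%N) (hSO' : (0 < #|SO'|)%N)
    (E : SO -> {set SC}) (Ech : SC -> {set SC'}) (Edec : SC' -> {set SO'})
    (hE : enabling_map E) (hEch : enabling_map Ech) (hEdec : enabling_map Edec)
    (W : SC -> SC' -> R) (hW : enabling_kernel Ech W) :
  [/\ sem_capacity E Edec W <= capacity W,
      sem_capacity E Edec W <= log2 (#|SO|%:R : R) /\
      sem_capacity E Edec W <= Num.min (capacity W) (log2 (#|SO|%:R : R))
    & (forall so : SO, E so = [set: SC]%SET) ->
      (forall sc' : SC', Edec sc' = [set: SO']%SET) ->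
      (#|SC| <= #|SO|)%N -> (#|SC'| <= #|SO'|)%N ->
      sem_capacity E Edec W = capacity W].
Proof.
have kW := hW.1.
(* Both capacities are attained, so optimal codes and inputs can be fixed. *)
have [[P [enc [dec [dP [ke _] [kd _] semE]]]] sem_ub] :=
  @sem_capacity_max R _ _ _ _ _ _ _ hSO hE hEdec kW.
have [[Q dQ capE] cap_ub] := @capacity_max R _ _ _ hSC kW.
have le_cap : sem_capacity E Edec W <= capacity W.
  have [Q' dQ' le_info] := sem_info_le dP ke kW kd.
  by rewrite semE; apply: le_trans le_info _; apply: cap_ub; exists Q'.
have le_log : sem_capacity E Edec W <= log2 (#|SO|%:R : R).
  have ksem := is_kernel_sem_kernel ke kW kd.
  rewrite semE; apply: mutual_info_le_log_card => [s s'|].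
    by rewrite mulr_ge0 ?dP.1 ?(ksem s).1.
  rewrite -dP.2; apply: eq_bigr => s _.
  by rewrite -mulr_sumr (ksem s).2 mulr1.
split=> //; first by split=> //; rewrite le_min le_cap.
move=> fullE fullD leSC leSC'; apply/eqP; rewrite eq_le le_cap/=.
have [f [g fK]] := leq_card_cancel hSC leSC.
have [h [k hK]] := leq_card_cancel hSC' leSC'.
have [P' dP' le_info] := mutual_info_le_sem_info fK hK dQ kW.
rewrite capE; apply: le_trans le_info _; apply: sem_ub.
(* These deterministic codes are admissible because every enabling set is full. *)
exists P', (fun s c => (c == g s)%:R), (fun c' s' => (s' == h c')%:R).
split=> //; split=> [x|x y _]; try exact: dirac_dist.
  by rewrite fullE finset.in_setT.
by rewrite fullD finset.in_setT.
Qed.
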